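(* Let $A$ be a $(0,1,\ast)$-matrix with $n$ columns. If $A$ contains $r$ rows which form an $r$-by-$n$ star-monotone submatrix of min-rank $r$, then $\mathrm{opt}(A)\leq 2^{n-r}$.
   Context: A $(0,1,\ast)$-matrix is a matrix with entries in $\{0,1,\ast\}$; all arithmetic is over $GF_2$. A completion of $A$ is a $(0,1)$-matrix obtained from $A$ by replacing each $\ast$ by $0$ or $1$; the min-rank of $A$ is the smallest $GF_2$-rank of a completion of $A$. For an $m$-by-$n$ $(0,1,\ast)$-matrix $A=(a_{ij})$, an operator $G=(g_1,\dots,g_m):\{0,1\}^n\to\{0,1\}^m$ is consistent with $A$ if each $g_i$ depends only on the variables $x_j$ with $a_{ij}=\ast$. A set $L\subseteq\{0,1\}^n$ is a solution for $A$ if there exist a completion $M$ of $A$ and an operator $G$ consistent with $A$ such that $M\mathbf{x}=G(\mathbf{x})$ for all $\mathbf{x}\in L$; $\mathrm{opt}(A)$ is the maximum size of a solution for $A$. An $r$-by-$n$ $(0,1,\ast)$-matrix is star-monotone if the sets $S_1,\dots,S_r$ of star positions in its rows (where $S_i=\{j: \text{entry } (i,j)=\ast\}$) form a chain $S_1\subseteq S_2\subseteq\cdots\subseteq S_r$. *)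

(* Defs.v *)
From mathcomp Require Import all_boot all_order all_algebra.

Set Implicit Arguments.
Unset Strict Implicit.
Unset Printing Implicit Defensive.

Import GRing.Theory.
Local Open Scope ring_scope.

(* [None] encodes the star. *)
Notation starmx m n := 'M[option 'F_2]_(m, n).

Definition star_set (m n : nat) (A : starmx m n) (i : 'I_m) : {set 'I_n} :=
  [set j | A i j == None].

Definition completion (m n : nat) (A : starmx m n) (M : 'M['F_2]_(m, n)) : bool :=
  [forall i, forall j, (A i j == None) || (A i j == Some (M i j))].

Definition zero_completion (m n : nat) (A : starmx m n) : 'M['F_2]_(m, n) :=
  \matrix_(i, j) odflt 0 (A i j).

Lemma zero_completionP (m n : nat) (A : starmx m n) :
  completion A (zero_completion A).
Proof.
by apply/forallP => i; apply/forallP => j; rewrite mxE; case: (A i j) => /=.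
Qed.

Definition min_rank (m n : nat) (A : starmx m n) : nat :=
  \rank [arg min_(M < zero_completion A | completion A M) \rank M]%N.

Lemma min_rank_attained (m n : nat) (A : starmx m n) :
  exists2 M, completion A M & \rank M = min_rank A.
Proof.
by rewrite /min_rank; case: arg_minnP => [|M cM _];
  [exact: zero_completionP | exists M].
Qed.

Lemma min_rank_le (m n : nat) (A : starmx m n) (M : 'M['F_2]_(m, n)) :
  completion A M -> (min_rank A <= \rank M)%N.
Proof.
by rewrite /min_rank; case: arg_minnP => [|N _ minN];
  [exact: zero_completionP | exact: minN].
Qed.

(* Two inputs that agree on the stars of row [i] have the same [i]-th output:
   [g_i] depends only on those variables. *)
Definition consistent (m n : nat) (A : starmx m n)
    (G : {ffun 'cV['F_2]_n -> 'cV['F_2]_m}) : bool :=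
  [forall i, forall x : 'cV['F_2]_n, forall y : 'cV['F_2]_n,
    [forall j in star_set A i, x j 0 == y j 0] ==> (G x i 0 == G y i 0)].

Definition solution (m n : nat) (A : starmx m n) (L : {set 'cV['F_2]_n}) : bool :=
  [exists M : 'M['F_2]_(m, n),
   exists G : {ffun 'cV['F_2]_n -> 'cV['F_2]_m},
    [&& completion A M, consistent A G & [forall x in L, M *m x == G x]]].

(* The empty set is always a solution, so the maximum is over a nonempty family. *)
Definition opt (m n : nat) (A : starmx m n) : nat :=
  (\max_(L : {set 'cV['F_2]_n} | solution A L) #|L|)%N.

Definition star_monotone (r n : nat) (B : starmx r n) : Prop :=
  forall i k : 'I_r, (i <= k)%N -> star_set B i \subset star_set B k.

(* Main.v *)
Require Import Defs.
From mathcomp Require Import all_boot all_order all_algebra.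

(** Let [S_0, ..., S_(r-1)] be the star sets of the [r] rows and [M] a
    completion of them. If row [k] of [M] coincided off [S_k] with a combination
    of the rows [i < k], refilling its stars would make it equal to that
    combination; so full min-rank provides, for each [k], a vector [y_k]
    supported off [S_k] with [M_k y_k = 1] and [M_i y_k = 0] for [i < k]. Let two
    points of a solution differ by [sum_k d_k y_k] and let [i] be the least index
    with [d_i <> 0]. As the [S_k] form a chain, the points agree on [S_i], so
    consistency gives them the same [i]-th output, although [M_i] separates them.
    Hence the translates of a solution by the [2^r] combinations of the [y_k] are
    pairwise disjoint. *)

Set Implicit Arguments.
Unset Strict Implicit.
Unset Printing Implicit Defensive.

Import GRing.Theory.
Local Open Scope ring_scope.

Lemma completionP (m n : nat) (A : starmx m n) (M : 'M['F_2]_(m, n)) :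
  reflect (forall i j, j \notin star_set A i -> A i j = Some (M i j))
          (completion A M).
Proof.
apply: (iffP forallP) => [cM i j | cM i].
  by rewrite inE => /negPf Aij; have /forallP/(_ j) := cM i; rewrite Aij => /eqP.
apply/forallP => j; case: eqP => //= /eqP Aij.
by apply/eqP/cM; rewrite inE.
Qed.

Lemma completion_rowsub (m n r : nat) (A : starmx m n) (f : 'I_r -> 'I_m)
    (M : 'M['F_2]_(m, n)) :
  completion A M -> completion (rowsub f A) (rowsub f M).
Proof.
move=> /completionP cM; apply/completionP => i j.
by rewrite inE !mxE => Aij; apply: cM; rewrite inE.
Qed.

Lemma F2_neq0 (a : 'F_2) : a != 0 -> a = 1.
Proof. by case: a => [[|[|//]]] // lt_a _; apply: val_inj. Qed.

Lemma row_not_comb_off_stars (r n : nat) (B : starmx r n)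
    (M : 'M['F_2]_(r, n)) (k : 'I_r) (u : 'rV['F_2]_r) :
  min_rank B = r -> completion B M -> u 0 k = 0 ->
  exists2 j, j \notin star_set B k & M k j != (u *m M) 0 j.
Proof.
move=> minrk /completionP cM u0.
apply/exists_inP; apply: contraT; rewrite negb_exists_in => /forall_inP eqM.
pose N := \matrix_(i, j) (if i == k then (u *m M) 0 j else M i j).
have cN : completion B N.
  apply/completionP => i j; rewrite mxE; case: eqP => [-> Sj|_]; last exact: cM.
  by move/(_ j Sj): eqM; rewrite negbK => /eqP <-; apply: cM.
have Nfree : row_free N.
  by rewrite /row_free eqn_leq rank_leq_row -{1}minrk min_rank_le.
(* [N] differs from [M] only in row [k], where [u] vanishes, so [u *m N = u *m M], which is row [k]
   of [N]. *)
have kerN : (u - delta_mx 0 k) *m N = 0.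
  apply/eqP; rewrite mulmxBl -rowE subr_eq0; apply/eqP/rowP => j.
  rewrite !mxE eqxx; apply: eq_bigr => i _; rewrite !mxE.
  by case: eqP => // ->; rewrite u0 // !mul0r.
have /rowP/(_ k)/eqP : u - delta_mx 0 k = 0.
  by apply: (row_free_inj Nfree); rewrite kerN mul0mx.
by rewrite !mxE !eqxx u0.
Qed.

Lemma separating_vector (r n : nat) (B : starmx r n) (M : 'M['F_2]_(r, n))
    (k : 'I_r) :
  min_rank B = r -> completion B M ->
  exists y : 'cV['F_2]_n,
    [/\ forall j, j \in star_set B k -> y j 0 = 0,
        (M *m y) k 0 = 1
      & forall i : 'I_r, (i < k)%N -> (M *m y) i 0 = 0].
Proof.
move=> minrk cM.
(* Right multiplication by [D] erases the columns in the stars of row [k]; left multiplication by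
   [E] keeps only the rows before [k]. *)
pose D := diag_mx (\row_j (j \notin star_set B k)%:R) : 'M['F_2]_n.
pose E := diag_mx (\row_i (i < k)%N%:R) : 'M['F_2]_r.
pose W := E *m M *m D.
have not_sub : ~~ (row k M *m D <= W)%MS.
  apply/negP => /submxP [u uE].
  have u0 : (u *m E) 0 k = 0 by rewrite mul_mx_diag !mxE ltnn mulr0.
  have [j Sj /eqP[]] := row_not_comb_off_stars minrk cM u0.
  have offS (v : 'rV_n) : (v *m D) 0 j = v 0 j.
    by rewrite mul_mx_diag !mxE Sj mulr1.
  by move/rowP/(_ j): uE; rewrite /W !mulmxA !offS mxE.
have [j yP] : exists j, (row k M *m D *m cokermx W) 0 j != 0.
  apply/existsP; move: not_sub; rewrite submxE; apply: contraR.
  rewrite negb_exists => /forallP v0; apply/eqP/rowP => j; rewrite [RHS]mxE.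
  by apply/eqP; rewrite -[_ == _]negbK.
(* The columns of [cokermx W] are annihilated by [W]; this one is not annihilated by row [k] of
   [M *m D]. Over GF(2) that nonzero value is 1. *)
pose y0 := col j (cokermx W).
have entry m (X : 'M_(m, n)) i : (X *m y0) i 0 = (X *m cokermx W) i j.
  by rewrite !mxE; apply: eq_bigr => l _; rewrite mxE.
exists (D *m y0); split=> [l Sl||i ik].
- by rewrite mul_diag_mx !mxE Sl mul0r.
- apply: F2_neq0; apply: contraNneq yP => y0E; apply/eqP; rewrite -y0E.
  by rewrite -!row_mul [LHS]mxE -entry mulmxA.
have /matrixP/(_ i j) : W *m cokermx W = 0 by rewrite mulmx_coker.
rewrite -entry /W -2!mulmxA mul_diag_mx [RHS]mxE => <-.
by rewrite [RHS]mxE [X in X * _]mxE ik mul1r mulmxA.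
Qed.

(** The separating vectors become the columns of [Y], which makes [M *m Y] lower unitriangular. *)
Lemma separating_matrix (r n : nat) (B : starmx r n) (M : 'M['F_2]_(r, n)) :
  min_rank B = r -> completion B M ->
  exists Y : 'M['F_2]_(n, r),
    [/\ forall k j, j \in star_set B k -> Y j k = 0,
        forall k, (M *m Y) k k = 1
      & forall i k : 'I_r, (i < k)%N -> (M *m Y) i k = 0].
Proof.
move=> minrk cM.
have /fin_all_exists [y yP] := fun k => separating_vector k minrk cM.
pose Y := \matrix_(j, k) y k j 0.
have MY i k : (M *m Y) i k = (M *m y k) i 0.
  by rewrite !mxE; apply: eq_bigr => j _; rewrite mxE.
exists Y; split=> [k j Sj|k|i k ik]; rewrite ?MY; have [y1 y2 y3] := yP k.
- by rewrite mxE y1.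
- exact: y2.
exact: y3.
Qed.

(** The last hypothesis on [x] and [x'] is what consistency yields for two points of a solution,
    with the operator eliminated. *)
Lemma solution_translate_inj (r n : nat) (B : starmx r n)
    (M : 'M['F_2]_(r, n)) (Y : 'M['F_2]_(n, r)) (x x' : 'cV['F_2]_n)
    (c c' : 'cV['F_2]_r) :
  star_monotone B ->
  (forall k j, j \in star_set B k -> Y j k = 0) ->
  (forall k, (M *m Y) k k = 1) ->
  (forall i k : 'I_r, (i < k)%N -> (M *m Y) i k = 0) ->
  (forall i, (forall j, j \in star_set B i -> x j 0 = x' j 0) ->
     (M *m x) i 0 = (M *m x') i 0) ->
  x + Y *m c = x' + Y *m c' -> c = c'.
Proof.
move=> mono Y0 MY1 MY0 agree eq_xc; apply/eqP; rewrite -subr_eq0.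
apply: contraT => cc'.
have [d dN0 x'E] : exists2 d, d <> 0 & x' = x + Y *m d.
  by exists (c - c'); [exact/eqP | rewrite mulmxBr addrA eq_xc addrK].
have /existsP [i0 di0] : [exists i, d i 0 != 0].
  apply: contraT; rewrite negb_exists => /forallP d0; case: dN0.
  by apply/colP => i; rewrite [RHS]mxE; apply/eqP; rewrite -[_ == _]negbK.
case: (@arg_minnP _ i0 (fun i => d i 0 != 0) (@nat_of_ord r) di0) => i di min_i.
have d_lt (k : 'I_r) : (k < i)%N -> d k 0 = 0.
  by move=> ki; apply: contraTeq ki => /min_i; rewrite -leqNgt.
have := agree i; rewrite x'E mulmxDr mulmxA [(_ + (M *m Y *m d)) i 0]mxE.
(* Terms [k < i] vanish by minimality of [i], terms [k > i] by triangularity. *)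
have -> : (M *m Y *m d) i 0 = d i 0.
  rewrite mxE (bigD1 i) //= MY1 mul1r big1 ?addr0 // => k ki.
  case: (ltngtP k i) => [/d_lt->|/MY0->|/val_inj/eqP]; rewrite ?mulr0 ?mul0r //.
  by rewrite (negPf ki).
move=> agree_i; case/eqP: di; apply/(addrI ((M *m x) i 0)).
rewrite addr0 -agree_i // => j Sj.
(* For [k >= i] the chain condition puts [j] among the stars of row [k], where column [k] of [Y] is
   zero. *)
rewrite !mxE big1 ?addr0 // => k _.
case: (ltnP k i) => [/d_lt->|ik]; first by rewrite mulr0.
by rewrite Y0 ?mul0r // (subsetP (mono _ _ ik)).
Qed.

Theorem theorem2 (m n r : nat) (A : 'M[option 'F_2]_(m, n)) (f : 'I_r -> 'I_m)
    (f_inj : injective f)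
    (mono : star_monotone (rowsub f A))
    (minrk : min_rank (rowsub f A) = r) :
  (opt A <= 2 ^ (n - r))%N.
Proof.
apply/bigmax_leqP => L /existsP [M /existsP [G]].
case/and3P=> cM /forallP cG /forall_inP LG.
have cM' := completion_rowsub f cM.
(* This keeps the subtraction [n - r] from being truncated. *)
have le_rn : (r <= n)%N.
  by rewrite -minrk (leq_trans (min_rank_le cM')) ?rank_leq_col.
have [Y [Y0 MY1 MY0]] := separating_matrix minrk cM'.
(* Injectivity of [t] on pairs from [L] and all coefficient vectors gives
   [#|L| * 2 ^ r <= 2 ^ n]. *)
pose t (p : 'cV['F_2]_n * 'cV['F_2]_r) := p.1 + Y *m p.2.
have t_inj : {in setX L setT &, injective t}.
  move=> [x c] [x' c'] /setXP[/LG/eqP xL _] /setXP[/LG/eqP x'L _] eq_t.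
  have eq_c : c = c'.
    apply: (solution_translate_inj mono Y0 MY1 MY0 _ eq_t) => i agree.
    have rowf z : (rowsub f M *m z) i 0 = (M *m z) (f i) 0.
      by rewrite mul_rowsub_mx mxE.
    rewrite !rowf xL x'L; apply/eqP.
    move/forallP/(_ x)/forallP/(_ x')/implyP: (cG (f i)); apply.
    apply/forall_inP => j; rewrite inE => Aj; apply/eqP/agree.
    by rewrite inE mxE.
  by move: eq_t; rewrite /t /= eq_c => /addIr ->.
have: (#|t @: setX L setT| <= 2 ^ n)%N.
  by rewrite (leq_trans (max_card _)) // card_mx card_Fp // muln1.
rewrite (card_in_imset t_inj) cardsX cardsT card_mx card_Fp // muln1.
have -> : (2 ^ n = 2 ^ (n - r) * 2 ^ r)%N by rewrite -expnD subnK.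
by rewrite leq_pmul2r // expn_gt0.
Qed.
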